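(* Let $G$ be a simple connected graph on $n$ vertices with maximum degree $\Delta=\Delta(G)$ and adjacency eigenvalues $\lambda_{\max}(G)=\lambda_1(G)\ge\cdots\ge\lambda_n(G)=\lambda_{\min}(G)$. Then $$-\lambda_{\min}(G)\,\lambda_{\max}(G)\ge \Delta.$$ Moreover, equality holds if and only if $G=H'+u$ is a cone graph over a $\delta$-regular graph $H'$ on $\Delta=n-1$ vertices (so $\Delta$ is the degree of $u$) whose minimum adjacency eigenvalue satisfies $$\lambda_{\min}(H')\ge \frac{1}{2}\left(\delta-\sqrt{\delta^2+4\Delta}\right).$$
   Context: Eigenvalues are those of the adjacency matrix. The cone graph $H'+u$ over a graph $H'$ is obtained from $H'$ by adding a new vertex $u$ and joining it to all vertices of $H'$. *)

(* Defs.v *)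
From mathcomp Require Import all_boot all_order all_algebra.
From mathcomp Require Import sesquilinear spectral complex polyrcf.

Set Implicit Arguments.
Unset Strict Implicit.
Unset Printing Implicit Defensive.

Import Order.TTheory GRing.Theory Num.Theory.
Local Open Scope ring_scope.

Record sgraph := SGraph {
  vertex :> finType;
  adj : rel vertex;
  adj_sym : symmetric adj;
  adj_irrefl : irreflexive adj
}.

Definition connected_graph (G : sgraph) : Prop :=
  (0 < #|G|)%N /\ forall x y : G, connect (@adj G) x y.

Definition degree (G : sgraph) (x : G) : nat := #|[set y : G | adj x y]|.

Definition max_degree (G : sgraph) : nat := (\max_(x : G) degree x)%N.

Definition regular_graph (d : nat) (G : sgraph) : Prop :=
  forall x : G, degree x = d.

Definition graph_iso (G H : sgraph) : Prop :=
  exists2 f : G -> H, bijective f & forall x y : G, adj (f x) (f y) = adj x y.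

(* The new vertex u is None. *)
Definition cone_adj (H : sgraph) : rel (option H) := fun x y =>
  match x, y with
  | Some a, Some b => adj a b
  | None, None => false
  | _, _ => true
  end.

Lemma cone_adj_sym (H : sgraph) : symmetric (@cone_adj H).
Proof. by case=> [a|] [b|] //=; apply: adj_sym. Qed.

Lemma cone_adj_irrefl (H : sgraph) : irreflexive (@cone_adj H).
Proof. by case=> [a|] //=; apply: adj_irrefl. Qed.

Definition cone (H : sgraph) : sgraph :=
  SGraph (@cone_adj_sym H) (@cone_adj_irrefl H).

Definition adjacency_mx (R : nzRingType) (G : sgraph) : 'M[R]_#|G| :=
  \matrix_(i, j) (adj (enum_val i) (enum_val j))%:R.

(* The roots in R of the characteristic polynomial, repeated according to     *)
(* their multiplicities, in nonincreasing order; see char_poly_spectrum. *)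
Definition spectrum (R : rcfType) (n : nat) (A : 'M[R]_n) : seq R :=
  sort >=%R (flatten [seq nseq (mup x (char_poly A)) x
                     | x <- rootsR (char_poly A)]).

Lemma char_poly_split (R : rcfType) (n : nat) (A : 'M[R]_n) :
  A^T = A -> exists s : seq R, char_poly A = \prod_(x <- s) ('X - x%:P).
Proof.
move=> Asym; pose f := real_complex R; pose B := map_mx f A.
have Bherm : B \is hermsymmx.
  apply: realsym_hermsym.
    by apply/is_hermitianmxP; rewrite expr0 scale1r map_mx_id // map_trmx Asym.
  by apply/mxOverP => i j; rewrite mxE; apply/complex_realP; exists (A i j).
have /orthomx_spectralP Beq := hermitian_normalmx Bherm.
have /mxOverP Dreal := hermitian_spectral_diag_real Bherm.
set P := spectralmx B in Beq; set D := spectral_diag B in Beq Dreal.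
exists [seq complex.Re (D 0 i) | i <- enum 'I_n].
apply: (map_poly_inj f); rewrite map_char_poly -/B.
have -> : char_poly B = char_poly (diag_mx D).
  have Pu : P \in unitmx by exact: spectral_unit.
  pose Q := map_mx polyC P; pose Q' := map_mx polyC (invmx P).
  have Q'Q : Q' *m Q = 1%:M by rewrite -map_mxM mulVmx // map_mx1.
  have E : char_poly_mx B = Q' *m char_poly_mx (diag_mx D) *m Q.
    rewrite /char_poly_mx mulmxBr mulmxBl Beq !map_mxM; congr (_ - _).
    by rewrite mul_mx_scalar -scalemxAl Q'Q scalemx1.
  rewrite /char_poly E !det_mulmx mulrAC -det_mulmx Q'Q det1.
  by rewrite mul1r.
rewrite char_poly_trig; last exact/is_diag_mx_is_trig/diag_mx_is_diag.
rewrite rmorph_prod big_map big_enum /=; apply: eq_bigr => i _.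
rewrite rmorphB /= map_polyX map_polyC /= mxE eqxx mulr1n.
by have /complex_realP[x ->] := Dreal 0 i.
Qed.

Lemma char_poly_spectrum (R : rcfType) (n : nat) (A : 'M[R]_n) :
  A^T = A -> char_poly A = \prod_(x <- spectrum A) ('X - x%:P).
Proof.
move=> /char_poly_split[s Es].
have p0 : char_poly A != 0 by rewrite monic_neq0 ?char_poly_monic.
suff sp : perm_eq (spectrum A) s by rewrite Es; apply/esym/perm_big.
rewrite /spectrum perm_sort; apply/allP => x _ /=; apply/eqP.
rewrite -(mu_prod_XsubC x s) -Es count_flatten -map_comp sumnE big_map.
have [xr|xr] := boolP (x \in rootsR (char_poly A)).
  rewrite (bigD1_seq x) ?uniq_roots //= count_nseq /= eqxx mul1n.
  rewrite big1_seq ?addn0 // => y /andP[yx _].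
  by rewrite /= count_nseq /= (negPf yx).
rewrite mupNroot; last first.
  by apply: contra xr => rx; rewrite -(roots_on_rootsR p0) inE /= rx.
rewrite big1_seq // => y /andP[_ yr]; rewrite /= count_nseq /=.
by case: eqP yr xr => // -> ->.
Qed.

Lemma size_spectrum (R : rcfType) (n : nat) (A : 'M[R]_n) :
  A^T = A -> size (spectrum A) = n.
Proof.
move=> /char_poly_spectrum/(congr1 (fun p : {poly R} => size p)).
by rewrite size_char_poly size_prod_XsubC => -[].
Qed.

Lemma adjacency_mx_sym (R : nzRingType) (G : sgraph) :
  (adjacency_mx R G)^T = adjacency_mx R G.
Proof. by apply/matrixP => i j; rewrite !mxE adj_sym. Qed.

(* On a graph without vertices both are 0. *)
Definition lambda_max (R : rcfType) (G : sgraph) : R :=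
  head 0 (spectrum (adjacency_mx R G)).

Definition lambda_min (R : rcfType) (G : sgraph) : R :=
  last 0 (spectrum (adjacency_mx R G)).

(* Main.v *)
(**
All eigenvalues of the adjacency matrix A lie in [m, M], where m and M are the
extreme ones, so (A - m)(M - A) is positive semidefinite. Its diagonal entry at
a vertex u is - m M - deg u, which gives the inequality. If it vanishes, the
whole row of u vanishes: for x <> u the number of common neighbours of u and x
is m + M when u ~ x, and 0 otherwise. By connectedness u is then adjacent to
every other vertex, and G - u is regular of degree m + M. The eigenvalue bound
on H = G - u is interlacing: an eigenvector of H extended by 0 is a test vector
for G. Conversely, an eigenvalue of the cone over a d-regular H is either an
eigenvalue of H or a root of x^2 - d x - |H|, hence lies between the two roots
of this polynomial, whose product is - |H|.
*)
Require Import Defs.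
From mathcomp Require Import all_boot all_order all_algebra.
From mathcomp Require Import sesquilinear spectral complex.
From mathcomp Require Import ring lra.

Set Implicit Arguments.
Unset Strict Implicit.
Unset Printing Implicit Defensive.

Import Order.TTheory GRing.Theory Num.Theory.
Local Open Scope ring_scope.

(** * Spectra of real symmetric matrices and positive semidefinite forms *)

Lemma mem_spectrum (R : rcfType) (n : nat) (A : 'M[R]_n) (a : R) :
  A^T = A -> (a \in spectrum A) = eigenvalue A a.
Proof.
move=> /char_poly_spectrum EA.
by rewrite eigenvalue_root_char EA root_prod_XsubC.
Qed.

Lemma expr_similar_diag (F : fieldType) (n k : nat) (P : 'M[F]_n)
    (d : 'rV[F]_n) :
  P \in unitmx ->
  (invmx P *m diag_mx d *m P) ^+ k
  = invmx P *m diag_mx (\row_i d 0 i ^+ k) *m P.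
Proof.
move=> Pu; elim: k => [|k IHk].
  rewrite expr0 -[LHS]/(1%:M) -(mulVmx Pu) -[in LHS](mulmx1 (invmx P)).
  by congr (_ *m _ *m _); apply/matrixP => i j; rewrite !mxE expr0.
rewrite exprSr IHk -[LHS]/(mulmx _ _) -!mulmxA (mulKVmx Pu).
congr (_ *m _); rewrite mulmxA mulmx_diag; congr (diag_mx _ *m _).
by apply/rowP => i; rewrite !mxE exprSr.
Qed.

(* The scalar spectral measure of [A] at [v]: mass [c i] at the point [s i]. *)
Lemma spectral_moments (R : rcfType) (n : nat) (A : 'M[R]_n) (v : 'rV[R]_n) :
  A^T = A ->
  exists c s : 'I_n -> R,
    [/\ forall i, 0 <= c i, forall i, s i \in spectrum A
      & forall k, (v *m A ^+ k *m v^T) 0 0 = \sum_i c i * s i ^+ k].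
Proof.
(* The spectral theorem is applied over [R[i]]; the conclusions descend to [R] because the
   eigenvalues of a Hermitian matrix are real. *)
move=> Asym; pose f := real_complex R; pose B := map_mx f A.
have Bherm : B \is hermsymmx.
  apply: realsym_hermsym.
    by apply/is_hermitianmxP; rewrite expr0 scale1r map_mx_id // map_trmx Asym.
  by apply/mxOverP => i j; rewrite mxE; apply/complex_realP; exists (A i j).
have /orthomx_spectralP Beq := hermitian_normalmx Bherm.
have /mxOverP Dreal := hermitian_spectral_diag_real Bherm.
have Pu := spectral_unit B; have Puni := spectral_unitarymx B.
set P := spectralmx B in Beq Pu Puni; set D := spectral_diag B in Beq Dreal.
have DE i : D 0 i = f (complex.Re (D 0 i)).
  by have /complex_realP[x ->] := Dreal 0 i.
pose y := map_mx f v *m invmx P.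
(* Here [P] is unitary and [v] is real, so the two outer factors of the diagonalised form are [y]
   and its conjugate transpose. *)
have yconj : P *m map_mx f v^T = map_mx (@Num.conj _) y^T.
  rewrite /y trmx_mul map_mxM /= (invmx_unitary Puni) trmxCK map_trmx.
  congr (_ *m _); apply/matrixP => i j; rewrite !mxE.
  exact/esym/conjc_real.
(* The mass at the [i]-th eigenvalue is the squared modulus of the [i]-th coordinate of [v] in the
   eigenbasis. *)
exists (fun i => complex.Re (y 0 i) ^+ 2 + complex.Im (y 0 i) ^+ 2).
exists (fun i => complex.Re (D 0 i)); split.
- by move=> i; rewrite addr_ge0 ?sqr_ge0.
- move=> i; rewrite mem_spectrum // eigenvalue_root_char.
  rewrite -(fmorph_root f) map_char_poly -[X in root _ X]DE -/B.
  rewrite -eigenvalue_root_char.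
  apply/eigenvalueP; exists (row i P).
    rewrite [in LHS]Beq !mulmxA -row_mul mulmxV // row1 -rowE row_diag_mx.
    by rewrite -scalemxAl -rowE.
  apply/eqP => Pi0; have /matrixP/(_ 0 i) : delta_mx 0 i = 0 :> 'rV[R[i]]_n.
    by rewrite -row1 -(mulmxV Pu) row_mul Pi0 mul0mx.
  by rewrite !mxE !eqxx => /eqP; rewrite oner_eq0.
move=> k; apply: (fmorph_inj f).
have BX : B ^+ k = invmx P *m diag_mx (\row_i D 0 i ^+ k) *m P.
  by rewrite [in LHS]Beq; apply: expr_similar_diag Pu.
have AX : map_mx f (A ^+ k) = B ^+ k.
  elim: k {BX} => [|k IHk]; first by rewrite !expr0 -[1]/(1%:M) map_mx1.
  by rewrite exprS -[A * _]/(A *m _) map_mxM IHk exprS.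
transitivity ((map_mx f (v *m A ^+ k *m v^T)) 0 0); first by rewrite [RHS]mxE.
rewrite !map_mxM AX BX !mulmxA -/y -mulmxA yconj mxE rmorph_sum.
apply: eq_bigr => i _.
have yE : f (complex.Re (y 0 i) ^+ 2 + complex.Im (y 0 i) ^+ 2)
          = y 0 i * (y 0 i)^*.
  by rewrite -normCK; apply: add_Re2_Im2.
rewrite rmorphM rmorphXn -[X in _ = _ * X ^+ k]DE [X in _ = X * _]yE.
rewrite mul_mx_diag mxE [in X in _ * X]mxE [in X in _ * X]mxE.
by rewrite [in X in _ * X * _]mxE mulrAC.
Qed.

Lemma spectrum_bounds (R : rcfType) (n : nat) (A : 'M[R]_n) (a : R) :
  a \in spectrum A -> last 0 (spectrum A) <= a <= head 0 (spectrum A).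
Proof.
have : sorted >=%R (spectrum A) by apply: sort_sorted => x y; apply: le_total.
case: (spectrum A) => // x s /=.
elim: s x a => [|y s IHs] x a /=.
  by move=> _; rewrite inE => /eqP ->; rewrite lexx.
move=> /andP[yx ys]; rewrite inE => /orP[/eqP->|/IHs].
  have /andP[h _] := IHs y y ys (mem_head _ _).
  by rewrite lexx andbT (le_trans h).
by move=> /(_ ys) /andP[-> /le_trans]; apply.
Qed.

Lemma rayleigh_min (R : rcfType) (n : nat) (A : 'M[R]_n) (v : 'rV[R]_n) :
  A^T = A ->
  last 0 (spectrum A) * (v *m v^T) 0 0 <= (v *m A *m v^T) 0 0.
Proof.
move=> /(spectral_moments v)[c [s [c0 sA mE]]].
have := mE 0%N; rewrite expr0 -[1]/(1%:M) mulmx1 => ->.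
have := mE 1%N; rewrite expr1 => ->.
rewrite mulr_sumr; apply: ler_sum => i _.
have /andP[h _] := spectrum_bounds (sA i).
by rewrite expr0 expr1 mulr1 mulrC ler_wpM2l.
Qed.

(* This is (A - a)(b - A). *)
Definition window_mx (R : rcfType) (n : nat) (A : 'M[R]_n) (a b : R) :
    'M[R]_n :=
  (a + b) *: A - (a * b)%:M - A *m A.

Lemma window_mx_sym (R : rcfType) (n : nat) (A : 'M[R]_n) (a b : R) :
  A^T = A -> (window_mx A a b)^T = window_mx A a b.
Proof.
by move=> As; rewrite /window_mx !linearB linearZ /= tr_scalar_mx trmx_mul As.
Qed.

(** Against the spectral measure of [v] the form is the sum of c_i (s_i - a)(b - s_i), and every s_i
    lies in [a, b]. *)
Lemma window_mx_ge0 (R : rcfType) (n : nat) (A : 'M[R]_n) (v : 'rV[R]_n) :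
  A^T = A ->
  let W := window_mx A (last 0 (spectrum A)) (head 0 (spectrum A)) in
  0 <= (v *m W *m v^T) 0 0.
Proof.
move=> As /=.
have [c [s [c0 sA mE]]] := spectral_moments v As.
set a := last _ _; set b := head _ _.
have := mE 0%N; rewrite expr0 -[1]/(1%:M) mulmx1 => m0.
have := mE 1%N; rewrite expr1 => m1.
have := mE 2%N; rewrite expr2 -[A * A]/(A *m A) => m2.
have -> : (v *m window_mx A a b *m v^T) 0 0 =
    (a + b) * (v *m A *m v^T) 0 0 - a * b * (v *m v^T) 0 0
    - (v *m (A *m A) *m v^T) 0 0.
  rewrite /window_mx !mulmxBr !mulmxBl mul_mx_scalar -scalemxAr -!scalemxAl.
  by rewrite !mxE.
rewrite m0 m1 m2 !mulr_sumr -!sumrB; apply: sumr_ge0 => i _.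
have /andP[ha hb] := spectrum_bounds (sA i).
have -> : (a + b) * (c i * s i ^+ 1) - a * b * (c i * s i ^+ 0) - c i * s i ^+ 2
  = c i * ((s i - a) * (b - s i)) by ring.
by rewrite mulr_ge0 // mulr_ge0 ?subr_ge0.
Qed.

(** With w = v W, the form at v + t w is 2 t |w|^2 + t^2 c. For a small negative t this is negative
    unless w = 0. *)
Lemma psd_kernel (R : rcfType) (n : nat) (W : 'M[R]_n) (v : 'rV[R]_n) :
  W^T = W -> (forall x : 'rV[R]_n, 0 <= (x *m W *m x^T) 0 0) ->
  (v *m W *m v^T) 0 0 = 0 -> v *m W = 0.
Proof.
move=> Ws W0; move wE : (v *m W) => w vW.
pose q := (w *m w^T) 0 0; pose c := (w *m W *m w^T) 0 0.
have c0 : 0 <= c by exact: W0.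
have qE : q = \sum_i w 0 i ^+ 2.
  by rewrite /q mxE; apply: eq_bigr => i _; rewrite mxE.
have E t : ((v + t *: w) *m W *m (v + t *: w)^T) 0 0 = 2 * t * q + t ^+ 2 * c.
  have wv : (w *m W *m v^T) 0 0 = q.
    by rewrite /q -[in w^T]wE trmx_mul Ws mulmxA.
  rewrite linearD linearZ /= mulmxDl mulmxDr !mulmxDl wE.
  rewrite -!(scalemxAl, scalemxAr) scalerA.
  rewrite ![(_ + _ : 'M_1) 0 0]mxE ![(_ *: _ : 'M_1) 0 0]mxE.
  by rewrite vW wv -/q -/c; ring.
(* Taking t = - q k gives the value - q^2 k (1 + k); the 1 added to c keeps the denominator positive
   when c = 0. *)
pose k := (c + 1)^-1.
have k0 : 0 < k by rewrite invr_gt0 ltr_wpDl.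
have kc : k * c = 1 - k.
  by rewrite /k -[X in X - _](@mulVf _ (c + 1)) ?gt_eqF ?ltr_wpDl //; ring.
have := W0 (v + (- (q * k)) *: w); rewrite E.
have -> : 2 * - (q * k) * q + (- (q * k)) ^+ 2 * c
  = - (q ^+ 2 * (k * (1 + k))).
  have -> : (- (q * k)) ^+ 2 * c = q ^+ 2 * k * (k * c) by ring.
  by rewrite kc; ring.
rewrite oppr_ge0 pmulr_lle0; last by rewrite mulr_gt0 // addr_gt0.
rewrite real_exprn_even_le0 ?num_real //= => /eqP q0.
apply/rowP => i; apply/eqP; rewrite mxE -sqrf_eq0; apply/eqP.
move: q0; rewrite qE => /psumr_eq0P; apply=> // j _; exact: sqr_ge0.
Qed.

Lemma delta_form (R : rcfType) (n : nat) (W : 'M[R]_n) (i : 'I_n) :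
  let e : 'rV_n := delta_mx 0 i in (e *m W *m e^T) 0 0 = W i i.
Proof. by rewrite /= -rowE trmx_delta -colE !mxE. Qed.

(** * Eigenfunctions, Rayleigh quotients and codegrees of a graph *)

Section Eigenfunctions.

Variables (R : rcfType) (G : sgraph).
Implicit Types (a : R) (g : G -> R) (x y : G).

(** Functions on vertices replace row vectors, which keeps the enumeration behind [adjacency_mx] out
    of the graph arguments. *)
Definition eigenfunction a g : Prop :=
  forall x, \sum_(y | adj x y) g y = a * g x.

Let A := adjacency_mx R G.

Definition row_of g : 'rV[R]_#|G| := \row_i g (enum_val i).

Lemma sum_enum_rank (F : 'I_#|G| -> R) :
  \sum_i F i = \sum_(x : G) F (enum_rank x).
Proof. by rewrite (reindex _ (onW_bij _ (@enum_rank_bij G))). Qed.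

Lemma row_of_adjacency g x :
  (row_of g *m A) 0 (enum_rank x) = \sum_(y | adj x y) g y.
Proof.
rewrite mxE sum_enum_rank [RHS]big_mkcond; apply: eq_bigr => y _.
rewrite !mxE !enum_rankK adj_sym.
by case: (adj x y); rewrite (mulr1, mulr0).
Qed.

Lemma row_of_dot g h :
  (row_of g *m (row_of h)^T) 0 0 = \sum_x g x * h x.
Proof.
by rewrite mxE sum_enum_rank; apply: eq_bigr => x _; rewrite !mxE !enum_rankK.
Qed.

Lemma mem_spectrum_adjacency a :
  a \in spectrum A <->
  exists2 g, eigenfunction a g & exists x, g x != 0.
Proof.
rewrite mem_spectrum ?adjacency_mx_sym //; split.
  move=> /eigenvalueP[v vA /eqP v0]; pose g x := v 0 (enum_rank x).
  have vE : v = row_of g by apply/rowP => i; rewrite mxE /g enum_valK.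
  exists g.
    by move=> x; rewrite -row_of_adjacency -vE vA mxE.
  apply/existsP; apply: contraT => /existsPn g0; case: v0.
  by apply/rowP => i; rewrite vE !mxE; apply/eqP/negPn/g0.
move=> [g gE [x gx]]; apply/eigenvalueP; exists (row_of g).
  apply/rowP => i; rewrite -(enum_valK i) row_of_adjacency gE !mxE.
  by rewrite enum_rankK.
by apply/eqP => /rowP/(_ (enum_rank x)); rewrite !mxE enum_rankK; apply/eqP.
Qed.

Lemma lambda_min_le a : a \in spectrum A -> lambda_min R G <= a.
Proof. by move=> /spectrum_bounds/andP[]. Qed.

Lemma lambda_min_mem : (0 < #|G|)%N -> lambda_min R G \in spectrum A.
Proof.
move=> G0; have : (0 < size (spectrum A))%N.
  by rewrite size_spectrum ?adjacency_mx_sym.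
rewrite /lambda_min -/A.
by case: (spectrum A) => //= x s _; apply: mem_last.
Qed.

Lemma lambda_max_mem : (0 < #|G|)%N -> lambda_max R G \in spectrum A.
Proof.
move=> G0; have : (0 < size (spectrum A))%N.
  by rewrite size_spectrum ?adjacency_mx_sym.
rewrite /lambda_max -/A.
by case: (spectrum A) => //= x s _; apply: mem_head.
Qed.

Lemma lambda_min_rayleigh g :
  lambda_min R G * (\sum_x g x * g x)
  <= \sum_x (\sum_(y | adj x y) g y) * g x.
Proof.
have := rayleigh_min (row_of g) (adjacency_mx_sym R G).
rewrite row_of_dot; congr (_ <= _).
rewrite mxE sum_enum_rank; apply: eq_bigr => x _.
by rewrite row_of_adjacency !mxE enum_rankK.
Qed.

Definition codegree x y : nat := #|[set z : G | adj x z && adj z y]|.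

Lemma adjacency_sq x y :
  (A *m A) (enum_rank x) (enum_rank y) = (codegree x y)%:R.
Proof.
rewrite mxE sum_enum_rank /codegree -sum1_card natr_sum [RHS]big_mkcond.
apply: eq_bigr => z _; rewrite !mxE !enum_rankK inE.
by do 2![case: (adj _ _)]; rewrite /= (mulr1, mulr0).
Qed.

Lemma codegree_diag x : codegree x x = degree x.
Proof. by apply: eq_card => z; rewrite !inE (adj_sym z) andbb. Qed.

Let m := lambda_min R G.
Let M := lambda_max R G.

Lemma window_entry x y :
  window_mx A m M (enum_rank x) (enum_rank y)
  = (m + M) * (adj x y)%:R - m * M * (x == y)%:R - (codegree x y)%:R.
Proof.
rewrite /window_mx [LHS]mxE [X in _ + X]mxE adjacency_sq !mxE !enum_rankK.
by rewrite (inj_eq enum_rank_inj) -[_ *+ (x == y)]mulr_natr.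
Qed.

Lemma degree_le x : (degree x)%:R <= - m * M.
Proof.
have := window_mx_ge0 (delta_mx 0 (enum_rank x)) (adjacency_mx_sym R G).
rewrite /= delta_form window_entry adj_irrefl eqxx codegree_diag -/m -/M.
by rewrite mulr0 mulr1 sub0r mulNr subr_ge0.
Qed.

(** The hypothesis makes the diagonal entry of the window matrix at [x] vanish, so [psd_kernel]
    annihilates its whole row; the claim reads off the entry at [y]. *)
Lemma degree_eq_codegree x y :
  - m * M = (degree x)%:R -> x != y ->
  (codegree x y)%:R = (m + M) * (adj x y)%:R.
Proof.
move=> xE xy; pose W := window_mx A m M.
have /rowP/(_ (enum_rank y)) :
    delta_mx 0 (enum_rank x) *m W = 0 :> 'rV_#|G|.
  apply: psd_kernel; first exact/window_mx_sym/adjacency_mx_sym.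
    by move=> v; apply/window_mx_ge0/adjacency_mx_sym.
  rewrite delta_form window_entry adj_irrefl eqxx codegree_diag.
  by rewrite mulr0 mulr1 sub0r -mulNr xE subrr.
rewrite -rowE [LHS]mxE window_entry (negPf xy) mulr0 subr0 mxE.
by move=> /eqP; rewrite subr_eq0 => /eqP.
Qed.

End Eigenfunctions.

(** * Isomorphism invariance and spectra of cones *)

Lemma graph_iso_sym (G H : sgraph) : graph_iso G H -> graph_iso H G.
Proof.
move=> [f [f' fK f'K] fE]; exists f'; first by exists f.
by move=> x y; rewrite -fE !f'K.
Qed.

Lemma graph_iso_card (G H : sgraph) : graph_iso G H -> #|G| = #|H|.
Proof. by move=> [f /bij_eq_card]. Qed.

(** An eigenfunction pulls back along the isomorphism. Membership is enough to compare extreme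
    eigenvalues. *)
Lemma graph_iso_spectrum (R : rcfType) (G H : sgraph) (a : R) :
  graph_iso G H ->
  a \in spectrum (adjacency_mx R H) -> a \in spectrum (adjacency_mx R G).
Proof.
move=> [f [f' fK f'K] fE] /mem_spectrum_adjacency[g gE [x gx]].
apply/mem_spectrum_adjacency; exists (g \o f); last first.
  by exists (f' x); rewrite /= f'K.
move=> z; rewrite /= -gE (reindex f); first by apply: eq_bigl => y; rewrite fE.
by exists f' => y _; [apply: fK | apply: f'K].
Qed.

Lemma sum_option (V : nmodType) (T : finType) (P : pred (option T))
    (F : option T -> V) :
  \sum_(x | P x) F x =
  (if P None then F None else 0) + \sum_(x | P (Some x)) F (Some x).
Proof.
rewrite big_mkcond (bigD1 None) //=; congr (_ + _).
rewrite (reindex_omap Some id); last by case.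
rewrite [RHS]big_mkcond; apply: eq_big => // x /=.
by rewrite eqxx.
Qed.

Lemma cone_lambda_min_le (R : rcfType) (H : sgraph) :
  (0 < #|H|)%N -> lambda_min R (cone H) <= lambda_min R H.
Proof.
move=> /(lambda_min_mem R)/mem_spectrum_adjacency[g gE [x0 gx0]].
(* Extension by 0 preserves the norm and the quadratic form: the apex row contributes the sum of [g]
   times the value 0. *)
have := @lambda_min_rayleigh R (cone H)
  (fun x => if x is Some y then g y else 0).
rewrite !sum_option /= !mulr0 !add0r.
under [X in _ <= X]eq_bigr => x _ do rewrite sum_option /= add0r gE -mulrA.
rewrite -mulr_sumr ler_pM2r // lt_def sumr_ge0 ?andbT; last first.
  by move=> x _; rewrite -expr2 sqr_ge0.
apply/eqP => /psumr_eq0P g0; move: gx0; rewrite -sqrf_eq0 expr2 g0 ?eqxx //.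
by move=> x _; rewrite -expr2 sqr_ge0.
Qed.

(** At a vertex where |g| is maximal, |a| |g x| is at most the sum of |g| over the [d] neighbours,
    hence at most d |g x|. *)
Lemma regular_spectrum_le (R : rcfType) (d : nat) (H : sgraph) (a : R) :
  regular_graph d H -> a \in spectrum (adjacency_mx R H) -> a <= d%:R.
Proof.
move=> Hd /mem_spectrum_adjacency[g gE [x0 gx0]].
have [x _ xmax] := @arg_maxP _ _ H x0 predT (fun x => `|g x|) isT.
have gx : 0 < `|g x| by apply: lt_le_trans (xmax x0 isT); rewrite normr_gt0.
rewrite (le_trans (ler_norm a)) // -(ler_pM2r gx) -normrM -gE.
apply: le_trans (ler_norm_sum _ _ _) _.
apply: (@le_trans _ _ (\sum_(y | adj x y) `|g x|)).
  by apply: ler_sum => y _; apply: xmax.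
rewrite sumr_const mulr_natl -(Hd x) /degree.
by rewrite (eq_card (B := [set y | adj x y])) // => y; rewrite !inE.
Qed.

(** An eigenfunction vanishing at the apex restricts to one of [H]. Otherwise, with S its sum over
    [H] and c its apex value, S = a c and |H| c + d S = a S; eliminating S and cancelling c gives
    the quadratic. *)
Lemma cone_spectrum (R : rcfType) (d : nat) (H : sgraph) (a : R) :
  regular_graph d H -> a \in spectrum (adjacency_mx R (cone H)) ->
  a ^+ 2 = d%:R * a + #|H|%:R \/ a \in spectrum (adjacency_mx R H).
Proof.
move=> Hd /mem_spectrum_adjacency[g gE [x0 gx0]].
pose S := \sum_(x : H) g (Some x).
have gN : S = a * g None.
  by have := gE None; rewrite sum_option /= add0r.
have gS x : g None + \sum_(y | adj x y) g (Some y) = a * g (Some x).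
  by have := gE (Some x); rewrite sum_option.
have [g0|g0] := eqVneq (g None) 0; [right|left].
  apply/mem_spectrum_adjacency; exists (g \o Some).
    by move=> x; rewrite -[RHS]gS g0 add0r.
  by case: x0 gx0 => [x gx|]; [exists x | rewrite g0 eqxx].
(* Double counting: by regularity each g (Some y) occurs [d] times. *)
have Sd : \sum_(x : H) \sum_(y | adj x y) g (Some y) = d%:R * S.
  rewrite (exchange_big_dep predT) //= mulr_sumr; apply: eq_bigr => y _.
  rewrite sumr_const mulr_natl -(Hd y) /degree; congr (_ *+ _).
  by apply: eq_card => z; rewrite !inE adj_sym.
have : \sum_(x : H) (g None + \sum_(y | adj x y) g (Some y)) = a * S.
  by rewrite mulr_sumr; apply: eq_bigr.
rewrite big_split /= Sd sumr_const gN => E.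
apply: (mulIf g0).
by rewrite mulrDl expr2 -!mulrA -E addrC [#|H|%:R * _]mulr_natl.
Qed.

(** * Deletion of a dominating vertex *)

Lemma delete_sym (G : sgraph) (u : G) :
  symmetric (fun x y : {x : G | x != u} => adj (val x) (val y)).
Proof. by move=> x y; apply: adj_sym. Qed.

Lemma delete_irrefl (G : sgraph) (u : G) :
  irreflexive (fun x y : {x : G | x != u} => adj (val x) (val y)).
Proof. by move=> x; apply: adj_irrefl. Qed.

Definition delete (G : sgraph) (u : G) : sgraph :=
  SGraph (@delete_sym G u) (@delete_irrefl G u).

Definition dominating (G : sgraph) (u : G) : Prop :=
  forall x : G, x != u -> adj u x.

Lemma dominating_cone (G : sgraph) (u : G) :
  dominating u -> graph_iso G (cone (delete u)).
Proof.
(* Out of the cone the bijection is a case analysis sending the apex to [u], with inverse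
   [insub]. *)
move=> udom; apply: graph_iso_sym.
pose f (o : cone (delete u)) : G := if o is Some x then val x else u.
exists f.
  exists (fun x => insub x : option {x : G | x != u}).
    by case=> [x|] /=; [rewrite valK | rewrite insubF ?eqxx].
  by move=> x; case: insubP => [y _ //|]; rewrite negbK => /eqP ->.
case=> [x|] [y|] //=; rewrite ?adj_irrefl //; last exact/udom/(valP y).
by rewrite adj_sym; apply/udom/(valP x).
Qed.

Lemma dominating_degree (G : sgraph) (u : G) :
  dominating u -> degree u = (#|G| - 1)%N.
Proof.
move=> udom; rewrite subn1 -(cardC1 u) /degree.
by apply: eq_card => x; rewrite !inE; apply/idP/idP => [|/udom //];
  apply: contraTneq => ->; rewrite adj_irrefl.
Qed.

(** Since [u] is adjacent to every vertex of [delete u], the neighbours of [x] there are exactly its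
    common neighbours with [u]. *)
Lemma delete_degree (G : sgraph) (u : G) (x : delete u) :
  dominating u -> degree x = codegree u (val x).
Proof.
move=> udom; rewrite /degree -(card_imset _ val_inj); apply: eq_card => z.
rewrite !inE; apply/imsetP/andP => [[y] |[uz zx]].
  by rewrite inE => xy ->; split; [apply/udom/(valP y) | rewrite adj_sym].
have zu : z != u by apply: contraTneq uz => ->; rewrite adj_irrefl.
by exists (exist _ z zu); rewrite // inE /= adj_sym.
Qed.

(* A vertex at distance 2 from [u] would be a non-neighbour sharing a neighbour
   with [u]. *)
Lemma codegree_dominating (G : sgraph) (u : G) :
  connected_graph G ->
  (forall x, x != u -> ~~ adj u x -> codegree u x = 0%N) ->
  dominating u.
Proof.
move=> [_ Gconn] u0.
pose S := [pred x | (x == u) || adj u x].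
have Ssym : connect_sym (@adj G) by apply/sym_connect_sym/adj_sym.
(* The closed neighbourhood of [u] is closed under adjacency, so by connectedness it contains every
   vertex. *)
have Scl : closed (@adj G) S.
  apply: (intro_closed Ssym) => x y xy; rewrite !inE => /orP[/eqP <-|ux].
    by rewrite xy orbT.
  case: eqVneq => //= yu; apply: contraT => /(u0 _ yu) /eqP.
  by rewrite cards_eq0 => /eqP/setP/(_ x); rewrite !inE ux xy.
move=> x xu; have := closed_connect Scl (Gconn u x).
by rewrite !inE eqxx (negPf xu).
Qed.

(** * Eigenvalue window of a cone and the equality case *)

(** The endpoints are the roots of x^2 - d x - |H|. An eigenvalue inherited from [H] is at most d,
    and d <= (d + D) / 2 because d <= D. *)
Lemma cone_lambda_bounds (R : rcfType) (d : nat) (H : sgraph) (a : R) :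
  let D : R := Num.sqrt (d%:R ^+ 2 + 4 * #|H|%:R) in
  regular_graph d H -> (d%:R - D) / 2 <= lambda_min R H ->
  a \in spectrum (adjacency_mx R (cone H)) ->
  (d%:R - D) / 2 <= a <= (d%:R + D) / 2.
Proof.
move=> D Hd Hmin aC; have D0 : 0 <= D by exact: sqrtr_ge0.
have D2 : D ^+ 2 = d%:R ^+ 2 + 4 * #|H|%:R.
  by rewrite sqr_sqrtr // addr_ge0 ?sqr_ge0 ?mulr_ge0 ?ler0n.
have dD : d%:R <= D.
  by rewrite -ler_sqr ?nnegrE ?ler0n // D2 lerDl mulr_ge0 ?ler0n.
have [aE|aH] := cone_spectrum Hd aC; last first.
  have := regular_spectrum_le Hd aH; have := lambda_min_le aH.
  by move=> h1 h2; apply/andP; split; lra.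
(* Completing the square in the quadratic equation for [a]. *)
have : `|2 * a - d%:R| ^+ 2 <= D ^+ 2.
  rewrite real_normK ?num_real // D2 -subr_ge0.
  have -> : d%:R ^+ 2 + 4 * #|H|%:R - (2 * a - d%:R) ^+ 2
    = 4 * (d%:R * a + #|H|%:R - a ^+ 2) :> R by ring.
  by rewrite aE subrr mulr0.
rewrite ler_sqr ?nnegrE // ler_norml => /andP[h1 h2].
by apply/andP; split; lra.
Qed.

Lemma max_degree_le (R : rcfType) (G : sgraph) :
  (0 < #|G|)%N -> (max_degree G)%:R <= - lambda_min R G * lambda_max R G.
Proof.
by move=> G0; have [u uE] := bigop.eq_bigmax (@degree G) G0;
  rewrite /max_degree uE degree_le.
Qed.

Lemma tight_cone (R : rcfType) (G : sgraph) :
  connected_graph G ->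
  - lambda_min R G * lambda_max R G = (max_degree G)%:R ->
  exists (H : sgraph) (d : nat),
    [/\ graph_iso G (cone H),
        regular_graph d H,
        #|H| = max_degree G,
        max_degree G = (#|G| - 1)%N
      & lambda_min R H >=
          (d%:R - Num.sqrt (d%:R ^+ 2 + 4 * (max_degree G)%:R)) / 2].
Proof.
move=> Gconn; have [G0 _] := Gconn.
have [u uE] := bigop.eq_bigmax (@degree G) G0; rewrite -/(max_degree G) in uE.
rewrite uE; set m := lambda_min R G; set M := lambda_max R G => tight.
have cod x : x != u -> (codegree u x)%:R = (m + M) * (adj u x)%:R.
  by rewrite eq_sym; apply: degree_eq_codegree.
have udom : dominating u.
  apply: codegree_dominating => // x /cod + /negPf ux.
  by rewrite ux mulr0 => /eqP; rewrite pnatr_eq0 => /eqP.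
pose H := delete u; have isoH : graph_iso G (cone H) by exact: dominating_cone.
have Hdeg (x : H) : (degree x)%:R = m + M.
  by rewrite delete_degree // cod ?(valP x) // udom ?(valP x) // mulr1.
have cardH : #|H| = (#|G| - 1)%N.
  by rewrite (graph_iso_card isoH) card_option subn1.
have uG := dominating_degree udom.
(* If [H] is empty, [G] is a single vertex; [d] is chosen to be 0, and [lambda_min R H] takes its
   default 0, so the bound reads 0 <= 0. *)
exists H; case: (pickP H) => [x _|H0]; last first.
  have cardH0 : #|H| = 0%N by exact: eq_card0.
  exists 0%N; split=> //; first by move=> x; have := H0 x.
    by rewrite uG.
  have -> : lambda_min R H = 0.
    have /size0nil : size (spectrum (adjacency_mx R H)) = 0%N.
      by rewrite size_spectrum ?adjacency_mx_sym.
    by rewrite /lambda_min => ->.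
  by rewrite uG -cardH cardH0 expr0n mulr0 addr0 sqrtr0 subrr mul0r.
exists (degree x); split=> //; last 1 first.
- have mM : m <= M by apply/lambda_min_le/lambda_max_mem.
  (* Both d = m + M and deg u = - m M are known, so the discriminant is (M - m)^2 and the required
     bound becomes m <= [lambda_min R H]. *)
  have -> : (degree x)%:R ^+ 2 + 4 * (degree u)%:R = (M - m) ^+ 2 :> R.
    by rewrite Hdeg -tight; ring.
  rewrite sqrtr_sqr ger0_norm ?subr_ge0 // Hdeg.
  have -> : (m + M - (M - m)) / 2 = m by lra.
  apply: (@le_trans _ _ (lambda_min R (cone H))).
    apply/lambda_min_le/(graph_iso_spectrum isoH)/lambda_min_mem.
    by rewrite card_option.
  by apply: cone_lambda_min_le; apply/card_gt0P; exists x.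
- by move=> y; apply/eqP; rewrite -(eqr_nat R) !Hdeg.
- by rewrite uG.
Qed.

(** The whole spectrum of [G] lies between two numbers with product - |H|, whence - m M <= |H|;
    [max_degree_le] is the reverse inequality. *)
Lemma cone_tight (R : rcfType) (G H : sgraph) (d : nat) :
  graph_iso G (cone H) -> regular_graph d H -> #|H| = max_degree G ->
  (d%:R - Num.sqrt (d%:R ^+ 2 + 4 * (max_degree G)%:R)) / 2 <= lambda_min R H ->
  - lambda_min R G * lambda_max R G = (max_degree G)%:R.
Proof.
move=> isoH Hd cardH; rewrite -cardH => Hmin.
have G0 : (0 < #|G|)%N by rewrite (graph_iso_card isoH) card_option.
have bnd a aG := cone_lambda_bounds Hd Hmin
  (@graph_iso_spectrum R _ _ a (graph_iso_sym isoH) aG).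
have /andP[hm _] := bnd _ (lambda_min_mem R G0).
have /andP[_ hM] := bnd _ (lambda_max_mem R G0).
have mM : lambda_min R G <= lambda_max R G.
  by apply/lambda_min_le/lambda_max_mem.
have := max_degree_le R G0; rewrite -cardH => low.
move: hm hM; set D := Num.sqrt _; set m := lambda_min R G in mM low *.
set M := lambda_max R G in mM low * => hm hM.
have D2 : D ^+ 2 = d%:R ^+ 2 + 4 * #|H|%:R.
  by rewrite sqr_sqrtr // addr_ge0 ?sqr_ge0 ?mulr_ge0 ?ler0n.
have dD : d%:R <= D.
  by rewrite -ler_sqr ?nnegrE ?ler0n ?sqrtr_ge0 // D2 lerDl mulr_ge0 ?ler0n.
(* The sign of M allows - m <= (D - d) / 2 to be multiplied by M. If M were negative, so would be m,
   and - m M < 0 would contradict [low]. *)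
have M0 : 0 <= M.
  rewrite leNgt; apply/negP => M0; have m0 := le_lt_trans mM M0.
  have := le_trans (ler0n R #|H|) low.
  by rewrite mulNr oppr_ge0 leNgt -mulrNN mulr_gt0 ?oppr_gt0.
apply/eqP; rewrite eq_le low andbT.
have -> : #|H|%:R = (D - d%:R) / 2 * ((d%:R + D) / 2) :> R.
  have -> : (D - d%:R) / 2 * ((d%:R + D) / 2) = (D ^+ 2 - d%:R ^+ 2) / 4 :> R.
    by field.
  by rewrite D2; field.
apply: (@le_trans _ _ ((D - d%:R) / 2 * M)).
  by apply: ler_wpM2r => //; lra.
by apply: ler_wpM2l => //; lra.
Qed.

Unset Implicit Arguments.

Theorem theorem3p1 (R : rcfType) (G : sgraph) (n : nat)
    (cardG : #|G| = n) (connG : connected_graph G) :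
  - lambda_min R G * lambda_max R G >= (max_degree G)%:R /\
  (- lambda_min R G * lambda_max R G = (max_degree G)%:R <->
   exists (H : sgraph) (d : nat),
     [/\ graph_iso G (cone H),
         regular_graph d H,
         #|H| = max_degree G,
         max_degree G = (n - 1)%N
       & lambda_min R H >=
           (d%:R - Num.sqrt (d%:R ^+ 2 + 4 * (max_degree G)%:R)) / 2]).
Proof.
split; first by apply: max_degree_le; case: connG.
split=> [|[H [d [isoH Hd cardH _ Hmin]]]]; last exact: cone_tight Hmin.
by rewrite -cardG; apply: tight_cone.
Qed.
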